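(* Let $K$ be a field, let $S=K[x_1,\ldots,x_n,y_1,\ldots,y_m]$, and let $0<q\leq n$ and $0<r\leq m$. If $S/I_qJ_r$ is a Cohen-Macaulay algebra, then $q=n$, $r=m$, and $$\operatorname{type}(S/I_qJ_r)=1.$$
   Context: $I_l$ (resp. $J_p$) denotes the ideal of $S=K[x_1,\ldots,x_n,y_1,\ldots,y_m]$ generated by all square-free monomials of degree $l$ in the variables $x_1,\ldots,x_n$ (resp. of degree $p$ in the variables $y_1,\ldots,y_m$). For a Cohen-Macaulay standard graded $K$-algebra $S/I$ (with $I$ a graded ideal of the polynomial ring $S$), $\operatorname{type}(S/I)$ denotes its Cohen-Macaulay type, which equals the last nonzero Betti number (the rank of the last nonzero free module) in the minimal graded free resolution of $S/I$ as an $S$-module. *)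

(* Defs.v *)
From HB Require Import structures.
From mathcomp Require Import all_boot all_order all_algebra.
From mathcomp Require Export ssrint ring_quotient.
From mathcomp Require Export mpoly.

Set Implicit Arguments.
Unset Strict Implicit.
Unset Printing Implicit Defensive.

Import GRing.Theory.
Local Open Scope ring_scope.

Section CommRing.
Variable R : comNzRingType.
Implicit Types (A I J : R -> Prop) (f : R) (fs : seq R) (d : nat).

Definition gen_ideal A f : Prop :=
  exists2 s : seq (R * R),
    forall p, p \in s -> A p.2 & f = \sum_(p <- s) p.1 * p.2.

Definition prod_ideal I J : R -> Prop :=
  gen_ideal (fun h => exists a b, [/\ I a, J b & h = a * b]).

(* Prime ideals of R / I are identified with prime ideals of R containing I. *)
Definition prime_chain I (P : nat -> prime_idealr R) d : Prop :=
  (forall i, (i <= d)%N -> forall f, I f -> f \in P i) /\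
  (forall i, (i < d)%N ->
     {subset P i <= P i.+1} /\ ~ {subset P i.+1 <= P i}).

Definition krull_dim_quot I d : Prop :=
  (exists P, prime_chain I P d) /\
  (forall e P, prime_chain I P e -> (e <= d)%N).

(* fs is a regular sequence on the module R / I. *)
Definition regular_seq_quot I fs : Prop :=
  (forall i, (i < size fs)%N ->
     let Ii := gen_ideal (fun g => I g \/ g \in take i fs) in
     forall g, Ii (fs`_i * g) -> Ii g) /\
  ~ gen_ideal (fun g => I g \/ g \in fs) 1.

End CommRing.

Section PolynomialRing.
Variables (K : fieldType) (k : nat).
Local Notation S := {mpoly K[k]}.
Implicit Types (I : S -> Prop) (f : S).

(* The graded maximal ideal (X_1, ..., X_k). *)
Definition irrelevant_ideal f : Prop := f@_0%MM = 0.

(* depth (S / I), the grade of the graded maximal ideal on S / I. *)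
Definition depth_quot I (d : nat) : Prop :=
  let in_max (fs : seq S) := forall f, f \in fs -> irrelevant_ideal f in
  (exists fs, [/\ in_max fs, regular_seq_quot I fs & size fs = d]) /\
  (forall fs, in_max fs -> regular_seq_quot I fs -> (size fs <= d)%N).

Definition cohen_macaulay_quot I : Prop :=
  exists d, krull_dim_quot I d /\ depth_quot I d.

Definition homog_of_deg f (z : int) : Prop :=
  match z with Posz d => f \is d.-homog | Negz _ => f = 0 end.

(* A finite minimal graded free resolution of the S-module S / I:
     0 -> F_p -> ... -> F_1 -> F_0 -> S / I -> 0,   F_i = (+)_j S(- shift i j).
   Elements of F_i are row vectors and maps act by right multiplication; the
   entries of aug represent the images in S / I of the basis of F_0. *)
Record min_graded_free_res I := MinGradedFreeRes {
  res_length : nat;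
  res_rank : nat -> nat;
  res_shift : forall i, 'I_(res_rank i) -> int;
  res_aug : 'cV[S]_(res_rank 0);
  res_diff : forall i, 'M[S]_(res_rank i.+1, res_rank i);
  res_rank_last : res_rank res_length <> 0%N;
  res_rank_gt : forall i, (res_length < i)%N -> res_rank i = 0%N;
  res_aug_homog : forall a, homog_of_deg (res_aug a ord0) (res_shift a);
  res_diff_homog : forall i (a : 'I_(res_rank i.+1)) (b : 'I_(res_rank i)),
    homog_of_deg (res_diff i a b) (res_shift a - res_shift b);
  res_aug_surj : forall f, exists u : 'rV_(res_rank 0),
    I ((u *m res_aug) ord0 ord0 - f);
  res_exact0 : forall u : 'rV_(res_rank 0),
    I ((u *m res_aug) ord0 ord0) <-> exists v, u = v *m res_diff 0;
  res_exactS : forall i (u : 'rV_(res_rank i.+1)),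
    u *m res_diff i = 0 <-> exists v, u = v *m res_diff i.+1;
  res_minimal : forall i a b, irrelevant_ideal (res_diff i a b)
}.

Definition last_betti_quot I (t : nat) : Prop :=
  exists F : min_graded_free_res I, t = res_rank F (res_length F).

(* "type (S / I) = t", to be used for Cohen-Macaulay S / I.  The uniqueness
   clause makes this independent of the choice of a resolution. *)
Definition cm_type_quot I (t : nat) : Prop := unique (last_betti_quot I) t.

End PolynomialRing.

(* In {mpoly K[n + m]} the variable x_i is 'X_(lshift m i) and y_j is
   'X_(rshift n j). *)
Section MixedProducts.
Variables (K : fieldType) (n m : nat).

Definition x_sqfree_ideal (l : nat) : {mpoly K[n + m]} -> Prop :=
  gen_ideal (fun f => exists2 A : {set 'I_n},
    #|A| = l & f = \prod_(i in A) 'X_(lshift m i)).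

Definition y_sqfree_ideal (p : nat) : {mpoly K[n + m]} -> Prop :=
  gen_ideal (fun f => exists2 B : {set 'I_m},
    #|B| = p & f = \prod_(j in B) 'X_(rshift n j)).

End MixedProducts.

Arguments x_sqfree_ideal : clear implicits.
Arguments y_sqfree_ideal : clear implicits.

(* Main.v *)
From HB Require Import structures.
Require Import Defs.
From mathcomp Require Import all_boot all_order all_algebra.
From mathcomp Require Import ring zify.

(** Write a = n - q + 1 and b = m - r + 1, the heights of I_q and J_r, and
    let k = n + m.  Any a of the x's, or any b of the y's, generate a prime
    ideal that contains I = I_q J_r, so adding the other variables one at a
    time to such a prime shows dim (S / I) >= max (k - a, k - b)
    ([mixed_product_dim_ge]).

    On the other hand depth (S / I) <= k - (a + b - 1), because the Koszul
    homology H_{a+b-1} (X; S / I) of the variables does not vanish.  For G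
    a set of a of the x's, H a set of b of the y's, and c the product of the
    remaining variables, the class is that of z = c d_y (e_{G, H}), where
    d = d_x + d_y is the Koszul differential split along the two groups of
    variables.  Indeed dz = c d_x d_y (e_{G, H}) has entries c x_i y_j, which lie
    in I, so z is a cycle over S / I.  If z were a boundary modulo I, then
    dz would have its entries in the irrelevant ideal times I, hence in degree
    greater than q + r, whereas c x_i y_j has degree q + r exactly
    ([mixed_product_koszul_class]).  That nonvanishing Koszul homology in
    degree i bounds every regular sequence in the irrelevant ideal by k - i
    is proved by transporting the class: if f is regular on S / J and
    f z = d w modulo J, then w is a nontrivial cycle one degree higher over
    S / (J + f) ([koszul_class_regular], [regular_seq_size]).

    If S / I is Cohen-Macaulay the two bounds give max (k - a, k - b) <=
    k - (a + b - 1), that is a = b = 1, so q = n and r = m.  The ideal I is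
    then generated by the product g of all the variables, and
    0 -> S -> S -> S / I -> 0 with the map g is a minimal resolution.  Any
    other minimal resolution has the same ranks 1, 1, 0, 0, ..., as one finds
    degree by degree by reducing modulo the irrelevant ideal
    ([principal_last_rank]). *)

Set Implicit Arguments.
Unset Strict Implicit.
Unset Printing Implicit Defensive.

Import GRing.Theory.
Local Open Scope ring_scope.

(** * The Koszul complex *)

Section Koszul.
Variables (R : comNzRingType) (k : nat).
Implicit Types (x g : 'I_k -> R) (z w : {set 'I_k} -> R) (B T : {set 'I_k}).

(** The element e_B of the exterior algebra is represented by the set B, its
    factors being taken in increasing order; this is the sign of moving
    e_j to its place in e_j e_B. *)
Definition koszul_sign (j : 'I_k) B : R := (-1) ^+ #|[set i in B | (i < j)%N]|.

Lemma koszul_signU j l B : l \notin B ->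
  koszul_sign j (l |: B) = (-1) ^+ (l < j)%N * koszul_sign j B.
Proof.
move=> lB; rewrite /koszul_sign -exprD; congr (_ ^+ _).
case: (ltnP l j) => lj.
  have -> : [set i in l |: B | (i < j)%N] = l |: [set i in B | (i < j)%N].
    by apply/setP => i; rewrite !inE; case: eqP => [->|]; rewrite ?lj.
  by rewrite cardsU1 !inE (negPf lB).
have -> // : [set i in l |: B | (i < j)%N] = [set i in B | (i < j)%N].
apply/setP => i; rewrite !inE; case: eqP => [->|//].
by rewrite ltnNge lj /= andbF.
Qed.

Lemma koszul_sign_sqr j B : koszul_sign j B * koszul_sign j B = 1.
Proof. by rewrite /koszul_sign -expr2 sqrr_sign. Qed.

Lemma koszul_sign_self j B : koszul_sign j (j |: B) = koszul_sign j B.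
Proof.
rewrite /koszul_sign; congr (_ ^+ _); apply: eq_card => i; rewrite !inE.
by case: (eqVneq i j) => [->|_] /=; rewrite ?ltnn ?andbF.
Qed.

Lemma koszul_signM j l B : j \notin B -> l \notin B -> j != l ->
  koszul_sign j (l |: B) * koszul_sign l (j |: B)
  = - (koszul_sign j B * koszul_sign l B).
Proof.
move=> jB lB jl; rewrite !koszul_signU // mulrACA -[RHS]mulN1r; congr (_ * _).
have : (j != l :> nat) by [].
by case: ltngtP => // _ _; rewrite /= expr0 expr1 ?mulr1 ?mul1r.
Qed.

Lemma koszul_sign_swap j l B : j \notin B -> l \notin B -> j != l ->
  koszul_sign j B * koszul_sign l (j |: B)
  = - (koszul_sign l B * koszul_sign j (l |: B)).
Proof.
move=> jB lB jl; rewrite !koszul_signU //.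
have : (j != l :> nat) by [].
by case: ltngtP => // _ _ /=;
  rewrite expr0 expr1 !mul1r !mulN1r !mulrN ?opprK mulrC.
Qed.

(** A chain is a function z standing for the sum of the z B e_B, with no
    restriction on the size of B.  The differential is contraction with x. *)
Definition koszul_diff x z B : R :=
  \sum_(j | j \notin B) koszul_sign j B * x j * z (j |: B).

(** Left multiplication by the degree 1 element with coordinates g. *)
Definition koszul_wedge g z B : R :=
  \sum_(j in B) koszul_sign j B * g j * z (B :\ j).

Lemma eq_koszul_diff x z w : z =1 w -> koszul_diff x z =1 koszul_diff x w.
Proof. by move=> zw B; apply: eq_bigr => j _; rewrite zw. Qed.

Lemma koszul_diffD x z w B :
  koszul_diff x (fun C => z C + w C) B = koszul_diff x z B + koszul_diff x w B.
Proof. by rewrite -big_split; apply: eq_bigr => j _; rewrite mulrDr. Qed.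

Lemma koszul_diffZ x c z B :
  koszul_diff x (fun C => c * z C) B = c * koszul_diff x z B.
Proof. by rewrite mulr_sumr; apply: eq_bigr => j _; rewrite mulrCA. Qed.

Lemma koszul_diffDl x y z B :
  koszul_diff (fun j => x j + y j) z B = koszul_diff x z B + koszul_diff y z B.
Proof. by rewrite -big_split; apply: eq_bigr => j _; rewrite mulrDr mulrDl. Qed.

(** The square of a contraction vanishes by this and not by its equality with
    its opposite, since 2 may be a zero divisor. *)
Lemma sum_alternating (A : 'I_k -> 'I_k -> R) :
    (forall j, A j j = 0) -> (forall j l, A j l = - A l j) ->
  \sum_j \sum_l A j l = 0.
Proof.
move=> A0 AN.
have split j : \sum_l A j l
    = \sum_(l : 'I_k | (j < l)%N) A j l + \sum_(l : 'I_k | (l < j)%N) A j l.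
  rewrite (bigD1 j) //= A0 add0r (bigID (fun l : 'I_k => (j < l)%N)) /=.
  by congr (_ + _); apply: eq_bigl => l; rewrite -val_eqE; case: ltngtP.
under eq_bigr do rewrite split.
rewrite big_split /= [X in _ + X](exchange_big_dep xpredT) //= -big_split /=.
apply: big1 => j _; rewrite -big_split /=.
by apply: big1 => l _; rewrite [A l j]AN subrr.
Qed.

Lemma koszul_diffK x z B : koszul_diff x (koszul_diff x z) B = 0.
Proof.
pose A j l := if [&& j \notin B, l \notin B & j != l] then
  koszul_sign j B * koszul_sign l (j |: B) * x j * x l * z (l |: (j |: B)) else 0.
rewrite -[RHS](@sum_alternating A); last first.
- move=> j l; rewrite /A [_ == _]eq_sym andbCA; case: ifP => [|_]; last by rewrite oppr0.
  case/and3P => lB jB lj.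
  rewrite koszul_sign_swap // 1?eq_sym // !mulNr setUCA; congr (- (_ * _)).
  by rewrite mulrAC.
- by move=> j; rewrite /A eqxx !andbF.
rewrite [RHS](bigID (fun j => j \notin B)) /= [X in _ = _ + X]big1 ?addr0; last first.
  by move=> j jB; apply: big1 => l _; rewrite /A (negPf jB).
apply: eq_bigr => j jB; rewrite mulr_sumr.
rewrite [RHS](bigID (fun l => l \notin j |: B)) /= [X in _ = _ + X]big1 ?addr0.
  apply: eq_bigr => l; rewrite !inE negb_or => /andP[lj lB].
  rewrite /A jB lB eq_sym lj /=; rewrite !mulrA; congr (_ * _ * _).
  by rewrite mulrAC.
move=> l; rewrite !inE negbK /A jB /= => /orP[/eqP-> | ->//].
by rewrite eqxx andbF.
Qed.

(** Multiplication by an element of the ideal (x) is null-homotopic: this is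
    why such an element annihilates the Koszul homology.  The terms in which
    two distinct indices are exchanged cancel, and the terms in which an index
    is added and then removed, or conversely, give the sum of the g j * x j. *)
Lemma koszul_homotopy x g z B :
  koszul_diff x (koszul_wedge g z) B + koszul_wedge g (koszul_diff x z) B
  = (\sum_j g j * x j) * z B.
Proof.
rewrite mulr_suml [RHS](bigID (fun j => j \notin B)) /=.
rewrite [X in _ = _ + X](eq_bigl (fun j => j \in B)); last by move=> j; rewrite negbK.
pose C j l : R :=
  koszul_sign j B * koszul_sign l (j |: B) * x j * g l * z (j |: B :\ l).
have -> : koszul_diff x (koszul_wedge g z) B =
    \sum_(j | j \notin B) (g j * x j * z B + \sum_(l in B) C j l).
  apply: eq_bigr => j jB; rewrite mulr_sumr big_setU1 //=; congr (_ + _).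
    rewrite koszul_sign_self setU1K // -[RHS]mul1r -(koszul_sign_sqr j B); ring.
  apply: eq_bigr => l lB; rewrite !mulrA; congr (_ * _ * _).
    by rewrite mulrAC.
  congr z; apply/setP => i; rewrite !inE; case: (eqVneq i j) => [->|] //=.
  by rewrite (contraNneq _ jB) // => ->.
have -> : koszul_wedge g (koszul_diff x z) B =
    \sum_(l in B) (g l * x l * z B - \sum_(j | j \notin B) C j l).
  apply: eq_bigr => l lB; rewrite mulr_sumr (bigD1 l) ?inE ?eqxx //=; congr (_ + _).
    rewrite setD1K // -[RHS]mul1r -(koszul_sign_sqr l (B :\ l)).
    rewrite -{1}(setD1K lB) koszul_sign_self; ring.
  rewrite -sumrN; apply: eq_big => j.
    by rewrite !inE negb_and negbK; case: (eqVneq j l) => [->|]; rewrite ?lB ?andbF ?andbT.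
  rewrite !inE negb_and negbK => /andP[jB jl]; rewrite (negPf jl) /= in jB.
  have lD : l \notin B :\ l by rewrite !inE eqxx.
  have jD : j \notin B :\ l by rewrite !inE (negPf jB) andbF.
  have -> : C j l = - (koszul_sign l B * koszul_sign j (B :\ l) * x j * g l
                       * z (j |: B :\ l)).
    rewrite /C -!mulNr; congr (_ * _ * _ * _).
    rewrite -{1 2}(setD1K lB) setUCA !koszul_sign_self koszul_signM 1?eq_sym //.
      by rewrite -{3}(setD1K lB) koszul_sign_self mulNr mulrC.
    by rewrite eq_sym.
  ring.
rewrite !big_split /= sumrN exchange_big /=; ring.
Qed.

Definition koszul_basis T B : R := (B == T)%:R.

Lemma koszul_diff_basis x T B :
  koszul_diff x (koszul_basis T) B
  = \sum_(l in T) (B == T :\ l)%:R * (koszul_sign l B * x l).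
Proof.
rewrite /koszul_diff big_mkcond [RHS]big_mkcond /=; apply: eq_bigr => l _.
have -> : (B == T :\ l) = (l \notin B) && (B == T :\ l).
  by case: eqP => [->|]; rewrite ?andbF // !inE eqxx.
rewrite /koszul_basis; case: ifPn => lB /=; last by rewrite mul0r if_same.
case: ifPn => lT.
  rewrite mulrC; congr (_%:R * _); congr nat_of_bool.
  by apply/eqP/eqP => [<-|->]; rewrite ?setU1K ?setD1K.
have [e|_] := eqVneq; last by rewrite mulr0.
by rewrite -e setU11 in lT.
Qed.

End Koszul.

(** * Ideals as predicates *)

Section Ideals.
Variable R : comNzRingType.
Implicit Types (A J : R -> Prop) (f g : R).

Definition is_ideal J : Prop :=
  J 0 /\ forall a f g, J f -> J g -> J (a * f + g).

Lemma is_idealM J a f : is_ideal J -> J f -> J (a * f).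
Proof. by case=> J0 JD Jf; rewrite -[a * f]addr0; apply: JD. Qed.

Lemma is_idealD J f g : is_ideal J -> J f -> J g -> J (f + g).
Proof. by case=> _ JD Jf Jg; rewrite -[f]mul1r; apply: JD. Qed.

Lemma is_idealB J f g : is_ideal J -> J f -> J g -> J (f - g).
Proof. by case=> _ JD Jf Jg; rewrite -mulN1r addrC; apply: JD. Qed.

Lemma is_ideal_sum J (T : Type) (s : seq T) (P : pred T) (F : T -> R) :
  is_ideal J -> (forall i, P i -> J (F i)) -> J (\sum_(i <- s | P i) F i).
Proof.
by move=> idJ JF; apply: big_ind => //; [case: idJ | move=> f g; apply: is_idealD].
Qed.

Lemma gen_ideal_is_ideal A : is_ideal (gen_ideal A).
Proof.
split=> [|a f g [s sA ->] [t tA ->]]; first by exists [::]; rewrite ?big_nil.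
exists ([seq (a * p.1, p.2) | p <- s] ++ t).
  by move=> p; rewrite mem_cat => /orP[/mapP[p' /sA Ap' ->] | /tA].
rewrite big_cat big_map mulr_sumr; congr (_ + _).
by apply: eq_bigr => p _; rewrite mulrA.
Qed.

Lemma sub_gen_ideal A f : A f -> gen_ideal A f.
Proof.
move=> Af; exists [:: (1, f)]; last by rewrite big_seq1 mul1r.
by move=> p; rewrite inE => /eqP->.
Qed.

Lemma gen_ideal_min A J f :
  is_ideal J -> (forall g, A g -> J g) -> gen_ideal A f -> J f.
Proof.
move=> idJ AJ [s sA ->]; rewrite big_seq; apply: is_ideal_sum => // p ps.
by apply: is_idealM => //; apply/AJ/sA.
Qed.

Lemma principal_is_ideal g : is_ideal (fun f => exists h, f = h * g).
Proof.
split=> [|a _ _ [h1 ->] [h2 ->]]; first by exists 0; rewrite mul0r.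
by exists (a * h1 + h2); ring.
Qed.

End Ideals.

(** * Koszul homology and regular sequences *)

Section KoszulClass.
Variables (R : comNzRingType) (k : nat) (x : 'I_k -> R).
Implicit Types (J : R -> Prop) (z w : {set 'I_k} -> R) (B : {set 'I_k}).

(** The Koszul homology of R / J in degree i is nonzero.  Chains over R / J are
    represented by chains over R; the chain w may have components in every
    degree, as d preserves the grading. *)
Definition koszul_class J i : Prop :=
  exists z, [/\ forall B, #|B| != i -> z B = 0,
                forall B, J (koszul_diff x z B)
              & ~ exists w, forall B, J (z B - koszul_diff x w B)].

Lemma koszul_diff_ideal J z B :
  is_ideal J -> (forall C, J (z C)) -> J (koszul_diff x z B).
Proof. by move=> idJ Jz; apply: is_ideal_sum => // j _; apply: is_idealM. Qed.

Lemma koszul_class_le J i : is_ideal J -> koszul_class J i -> (i <= k)%N.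
Proof.
move=> idJ [z [z_supp _ nz]]; rewrite leqNgt; apply/negP => ki.
case: nz; exists (fun=> 0) => B.
rewrite z_supp; last first.
  by rewrite neq_ltn (leq_ltn_trans _ ki) // -[k in (_ <= k)%N]card_ord max_card.
by apply: is_idealB => //; [case: idJ | apply: koszul_diff_ideal => // _; case: idJ].
Qed.

(** The connecting map of the sequence 0 -> R/J -> R/J -> R/J' -> 0 given by f
    is onto H_i (x; R/J), as f acts there by zero.  On chains, f z = d w modulo
    J for the chain w = koszul_wedge g z, which is thus a cycle over R/J'.  Were
    w equal to d v + s f modulo J, then f z = f d s modulo J, and z would be the
    boundary d s as f is regular. *)
Lemma koszul_class_regular J J' f g i :
    is_ideal J -> f = \sum_j g j * x j -> (forall h, J (f * h) -> J h) ->
    (forall h, J' h <-> exists a, J (h - a * f)) ->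
  koszul_class J i -> koszul_class J' i.+1.
Proof.
move=> idJ fE regf J'E [z [z_supp dz nz]].
have JdE B : J (koszul_wedge g (koszul_diff x z) B).
  by apply: is_ideal_sum => // j _; apply: is_idealM.
exists (koszul_wedge g z); split=> [B szB | B | [w Jw]].
- apply: big1 => j jB; rewrite z_supp ?mulr0 //.
  by apply: contraNneq szB => <-; rewrite (cardsD1 j) jB.
- apply/J'E; exists (z B).
  have -> : koszul_diff x (koszul_wedge g z) B - z B * f =
      0 - koszul_wedge g (koszul_diff x z) B.
    by rewrite [z B * f]mulrC fE -koszul_homotopy; ring.
  by apply: is_idealB => //; case: idJ.
- have [s Js] : exists s, forall B, J (koszul_wedge g z B - koszul_diff x w B - s B * f).
    (* There are finitely many B: the coefficients of f are chosen together. *)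
    apply: (fin_all_exists (P := fun B a =>
      J (koszul_wedge g z B - koszul_diff x w B - a * f))) => B.
    exact/J'E.
  apply: nz; exists s => B; apply: regf.
  have -> : f * (z B - koszul_diff x s B) =
     koszul_wedge g (koszul_diff x z) B
     + koszul_diff x (fun C => koszul_wedge g z C - koszul_diff x w C - s C * f) B.
    have -> : koszul_diff x (fun C => koszul_wedge g z C - koszul_diff x w C - s C * f) B
       = koszul_diff x (koszul_wedge g z) B - f * koszul_diff x s B.
      transitivity (koszul_diff x (fun C => koszul_wedge g z C +
         (-1 * koszul_diff x w C + - f * s C)) B).
        by apply: eq_koszul_diff => C; ring.
      by rewrite !koszul_diffD !koszul_diffZ koszul_diffK; ring.
    by rewrite mulrBr {1}fE -koszul_homotopy; ring.
  by apply: is_idealD => //; apply: koszul_diff_ideal.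
Qed.
End KoszulClass.

Section RegularSequences.
Variables (K : fieldType) (k : nat).
Local Notation S := {mpoly K[k]}.
Implicit Types (I : S -> Prop) (f : S).

(** Every nonconstant monomial is a multiple of a variable. *)
Lemma irrelevant_idealP f :
  irrelevant_ideal f -> exists g : 'I_k -> S, f = \sum_j g j * 'X_j.
Proof.
move=> f0; rewrite [f]mpolyE big_seq.
apply: (big_ind (fun h : S => exists g : 'I_k -> S, h = \sum_j g j * 'X_j)).
- by exists (fun=> 0); rewrite big1 // => j _; rewrite mul0r.
- move=> _ _ [g ->] [h ->]; exists (fun j => g j + h j).
  by rewrite -big_split; apply: eq_bigr => j _; rewrite mulrDl.
move=> m; rewrite mcoeff_msupp => fm.
have [j mj] : exists j, m j != 0%N.
  apply/existsP; rewrite -negb_forall; apply: contraNN fm => /forallP m0.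
  rewrite (_ : m = 0%MM) ?f0 //; apply/mnmP => j; rewrite mnm0E; exact/eqP.
exists (fun i => if i == j then f@_m *: 'X_[m - U_(j)] else 0).
rewrite (bigD1 j) //= eqxx big1 => [|i /negPf->]; last by rewrite mul0r.
by rewrite addr0 -scalerAl -mpolyXD submK // lep1mP.
Qed.

(** Half of the depth sensitivity of the Koszul complex: each term of the regular
    sequence raises the degree of a nonzero class by one, and there is no class
    above degree k. *)
Lemma regular_seq_size I fs i :
    is_ideal I -> (forall f, f \in fs -> irrelevant_ideal f) ->
    regular_seq_quot I fs -> koszul_class (fun j => 'X_j) I i ->
  (i + size fs <= k)%N.
Proof.
move=> idI fs0 [reg_fs _] HI.
pose J t := gen_ideal (fun g => I g \/ g \in take t fs).
have idJ t : is_ideal (J t) by apply: gen_ideal_is_ideal.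
suff H t : (t <= size fs)%N -> koszul_class (fun j => 'X_j) (J t) (i + t)%N.
  exact: koszul_class_le (idJ _) (H _ (leqnn _)).
elim: t => [_|t IHt lt_t].
  have JI h : J 0%N h <-> I h.
    split; last by move=> Ih; apply: sub_gen_ideal; left.
    by apply: gen_ideal_min => // g [|]; rewrite // take0.
  rewrite addn0; case: HI => z [z_supp dz nz]; exists z; split=> // [B|[w Jw]].
    exact/JI.
  by apply: nz; exists w => B; apply/JI.
have [g gE] := irrelevant_idealP (fs0 _ (mem_nth 0 lt_t)).
rewrite addnS; apply: (koszul_class_regular (idJ t) gE _ _ (IHt (ltnW lt_t))).
  exact: reg_fs.
move=> h; split.
  rewrite {1}/J (take_nth 0) //.
  apply: (gen_ideal_min (J := fun h => exists a, J t (h - a * fs`_t))).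
    split=> [|a f1 f2 [a1 J1] [a2 J2]].
      by exists 0; rewrite mul0r subrr; case: (idJ t).
    exists (a * a1 + a2).
    have -> : a * f1 + f2 - (a * a1 + a2) * fs`_t
        = a * (f1 - a1 * fs`_t) + (f2 - a2 * fs`_t) by ring.
    by apply: is_idealD => //; apply: is_idealM.
  move=> f [If|]; first by exists 0; rewrite mul0r subr0; apply: sub_gen_ideal; left.
  rewrite mem_rcons inE => /orP[/eqP->|ft].
    by exists 1; rewrite mul1r subrr; case: (idJ t).
  by exists 0; rewrite mul0r subr0; apply: sub_gen_ideal; right.
case=> a Ja; rewrite -[h](subrK (a * fs`_t)); apply: is_idealD => //.
  apply: gen_ideal_min Ja => // f [If|ft]; apply: sub_gen_ideal; [by left|right].
  by rewrite (take_nth 0) // mem_rcons inE ft orbT.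
apply: is_idealM => //; apply: sub_gen_ideal; right.
by rewrite (take_nth 0) // mem_rcons inE eqxx.
Qed.

End RegularSequences.

(** * Primes generated by variables *)

Section VariablePrimes.
Variables (K : fieldType) (k : nat).
Local Notation S := {mpoly K[k]}.
Implicit Types (W : {set 'I_k}) (f : S).

Definition kill_vars W : S -> S :=
  mmap (@mpolyC k K) (fun j => if j \in W then 0 else 'X_j).

HB.instance Definition _ W := GRing.RMorphism.copy (kill_vars W)
  (mmap (@mpolyC k K) (fun j => if j \in W then 0 else 'X_j)).

(** The ideal generated by the variables in W, as the kernel of a morphism to a
    domain: membership is decidable and primality immediate. *)
Definition vars_ideal W : S -> bool := fun f => kill_vars W f == 0.

Lemma kill_varsX W j : kill_vars W 'X_j = if j \in W then 0 else 'X_j.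
Proof. by rewrite /kill_vars mmapX mmap1U. Qed.

Lemma vars_ideal_closed W : idealr_closed (vars_ideal W).
Proof.
rewrite /vars_ideal /kill_vars; split; rewrite -?topredE /=.
- by rewrite raddf0.
- by rewrite rmorph1 oner_eq0.
move=> a f g; rewrite -!topredE /= => /eqP f0 /eqP g0.
by rewrite rmorphD rmorphM /= f0 g0 mulr0 addr0.
Qed.

Lemma vars_ideal_prime W : prime_idealr_closed (vars_ideal W : {pred S}).
Proof.
by move=> f g; rewrite /vars_ideal /kill_vars -!topredE /= rmorphM mulf_eq0.
Qed.

HB.instance Definition _ W := isIdealr.Build S (vars_ideal W) (vars_ideal_closed W).
HB.instance Definition _ W :=
  isPrimeIdealrClosed.Build S (vars_ideal W) (@vars_ideal_prime W).

Lemma kill_vars_sub W W' f : W \subset W' -> kill_vars W' (kill_vars W f) = kill_vars W' f.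
Proof.
move=> sWW'; rewrite {2}/kill_vars /mmap [LHS]raddf_sum; apply: eq_bigr => m _.
rewrite /= /kill_vars rmorphM /= mmapC; congr (_ * _).
rewrite /mmap1 rmorph_prod; apply: eq_bigr => j _; rewrite rmorphXn /=; congr (_ ^+ _).
case: ifP => [jW|_]; first by rewrite (subsetP sWW') // raddf0.
exact: kill_varsX.
Qed.

Lemma vars_prime_chain (I : S -> Prop) (W : nat -> {set 'I_k}) d :
    (forall i f, I f -> kill_vars (W i) f = 0) ->
    (forall i, (i < d)%N -> W i \proper W i.+1) ->
  prime_chain I (fun i => vars_ideal (W i)) d.
Proof.
move=> IW sW; split=> [i _ f /(IW i) f0 | i /sW /properP[sWi [j jW jNW]]].
  by rewrite -topredE /= /vars_ideal f0.
split=> [f | /(_ 'X_j)]; rewrite -!topredE /= /vars_ideal.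
  by move=> /eqP f0; rewrite -(kill_vars_sub f sWi) f0 /kill_vars raddf0.
rewrite !kill_varsX jW (negPf jNW) eqxx => /(_ isT) /eqP /(congr1 (mcoeff U_(j))).
by rewrite mcoeffX eqxx mcoeff0 => /eqP; rewrite oner_eq0.
Qed.

End VariablePrimes.

(** * A nonzero Koszul class of the mixed product *)

Section Diagonal.
Variables (K : fieldType) (k : nat).
Local Notation S := {mpoly K[k]}.

(** Setting all the variables equal turns the degree of a monomial into an
    order of vanishing at 0, which is easily compared. *)
Definition diagonal : S -> {poly K} := mmap (@polyC K) (fun=> 'X).

HB.instance Definition _ :=
  GRing.RMorphism.copy diagonal (mmap (@polyC K) (fun=> 'X)).

Lemma diagonalX j : diagonal 'X_j = 'X.
Proof. by rewrite /diagonal mmapX mmap1U. Qed.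

Lemma diagonal_prod (T : finType) (A : {set T}) (v : T -> 'I_k) :
  diagonal (\prod_(i in A) 'X_(v i)) = 'X^#|A|.
Proof.
rewrite rmorph_prod /= (eq_bigr (fun=> 'X)) ?prodr_const // => i _.
exact: diagonalX.
Qed.

Lemma diagonal_order_ideal d :
  is_ideal (fun f => exists h, diagonal f = 'X^d * h).
Proof.
split=> [|a f g [h1 e1] [h2 e2]]; first by exists 0; rewrite raddf0 mulr0.
by exists (diagonal a * h1 + h2); rewrite rmorphD rmorphM /= e1 e2; ring.
Qed.

End Diagonal.

Section MixedProducts.
Variables (K : fieldType) (n m q r : nat).
Local Notation S := {mpoly K[n + m]}.
Local Notation I := (prod_ideal (x_sqfree_ideal K n m q) (y_sqfree_ideal K n m r)).

Let xs (A : {set 'I_n}) : S := \prod_(i in A) 'X_(lshift m i).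
Let ys (B : {set 'I_m}) : S := \prod_(j in B) 'X_(rshift n j).

Lemma mixed_product_is_ideal : is_ideal I.
Proof. exact: gen_ideal_is_ideal. Qed.

Lemma mixed_product_gen (A : {set 'I_n}) (B : {set 'I_m}) :
  #|A| = q -> #|B| = r -> I (xs A * ys B).
Proof.
move=> Aq Br; apply: sub_gen_ideal; exists (xs A), (ys B); split=> //.
  by apply: sub_gen_ideal; exists A.
by apply: sub_gen_ideal; exists B.
Qed.

(** J1 and J2 carry what is to be known of the two factors, such as orders of
    vanishing that add up to the one recorded by J. *)
Lemma mixed_product_min (J J1 J2 : S -> Prop) f :
    is_ideal J -> is_ideal J1 -> is_ideal J2 ->
    (forall A : {set 'I_n}, #|A| = q -> J1 (xs A)) ->
    (forall B : {set 'I_m}, #|B| = r -> J2 (ys B)) ->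
    (forall a b, J1 a -> J2 b -> J (a * b)) ->
  I f -> J f.
Proof.
move=> idJ id1 id2 J1x J2y J12; apply: gen_ideal_min => // _ [a [b [Ia Ib ->]]].
apply: J12.
  by apply: gen_ideal_min Ia => // _ [A Aq ->]; apply: J1x.
by apply: gen_ideal_min Ib => // _ [B Br ->]; apply: J2y.
Qed.

Lemma diagonal_mixed_product f : I f -> exists h, diagonal f = 'X^(q + r) * h.
Proof.
pose idD := @diagonal_order_ideal K (n + m).
apply: (mixed_product_min (idD (q + r)%N) (idD q) (idD r)) => [A Aq|B Br|a b [g eg] [h eh]].
- by exists 1; rewrite diagonal_prod Aq mulr1.
- by exists 1; rewrite diagonal_prod Br mulr1.
by exists (g * h); rewrite rmorphM /= eg eh exprD mulrACA.
Qed.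

(** The degree of the class is (#|G| + #|H|).-1 and not #|G| + #|H|, the sum of
    the projective dimensions of the quotients by I_q and J_r: their product is
    the tensor product over K of an ideal of K[x] and an ideal of K[y], and
    passing from a quotient to the ideal lowers each projective dimension by
    one, while passing back raises it by one only once. *)
Lemma mixed_product_koszul_class (G : {set 'I_n}) (H : {set 'I_m}) :
    (0 < #|G|)%N -> (0 < #|H|)%N -> #|~: G|.+1 = q -> #|~: H|.+1 = r ->
  koszul_class (fun j => 'X_j : S) I (#|G| + #|H|).-1.
Proof.
move=> /card_gt0P[i0 Gi0] /card_gt0P[j0 Hj0] Gq Hr.
have idI := mixed_product_is_ideal.
pose T := (lshift m @: G) :|: (@rshift n m @: H).
have TG i : (lshift m i \in T) = (i \in G).
  rewrite inE mem_imset; last exact: lshift_inj.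
  by case: imsetP => [[j _ /eqP]|_]; rewrite ?eq_lrshift ?orbF.
have TH j : (rshift n j \in T) = (j \in H).
  rewrite inE orbC mem_imset; last exact: rshift_inj.
  by case: imsetP => [[i _ /eqP]|_]; rewrite ?eq_rlshift ?orbF.
have cardT : #|T| = (#|G| + #|H|)%N.
  rewrite cardsU (card_imset _ (@lshift_inj _ _)) (card_imset _ (@rshift_inj _ _)).
  rewrite (_ : _ :&: _ = set0) ?cards0 ?subn0 //.
  apply/setP => l; rewrite !inE; apply/negP => /andP[/imsetP[i _ ->] /imsetP[j _ /eqP]].
  by rewrite eq_lrshift.
(* T is kept opaque, so that membership in it is only unfolded by TG and TH. *)
clearbody T.
(* The Koszul differentials with weights x and y are d_x and d_y. *)
pose x l : S := if split l is inl _ then 'X_l else 0.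
pose y l : S := if split l is inr _ then 'X_l else 0.
have xl i : x (lshift m i) = 'X_(lshift m i) by rewrite /x (unsplitK (inl _ i)).
have xr j : x (rshift n j) = 0 by rewrite /x (unsplitK (inr _ j)).
have yl i : y (lshift m i) = 0 by rewrite /y (unsplitK (inl _ i)).
have yr j : y (rshift n j) = 'X_(rshift n j) by rewrite /y (unsplitK (inr _ j)).
pose e := koszul_basis S T.
pose c := xs (~: G) * ys (~: H).
pose z B := c * koszul_diff y e B.
have dzE B : koszul_diff (fun j => 'X_j) z B = c * koszul_diff x (koszul_diff y e) B.
  rewrite /z koszul_diffZ; congr (_ * _).
  transitivity (koszul_diff (fun j => x j + y j) (koszul_diff y e) B).
    by apply: eq_bigr => j _; rewrite /x /y; case: split => _; rewrite ?addr0 ?add0r.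
  by rewrite koszul_diffDl koszul_diffK addr0.
have cI p l : p \in T -> l \in T -> I (c * x p * y l).
  rewrite -[p]splitK -[l]splitK; case: (split p) => [i|j]; case: (split l) => [i'|j'] /=;
    rewrite ?xl ?xr ?yl ?yr ?mulr0 ?mul0r; try by case: idI.
  rewrite TG TH => iG jH.
  have -> : c * 'X_(lshift m i) * 'X_(rshift n j') = xs (i |: ~: G) * ys (j' |: ~: H).
    by rewrite /xs /ys !big_setU1 ?inE ?iG ?jH //= /c /xs /ys; ring.
  by apply: mixed_product_gen; rewrite cardsU1 !inE ?iG ?jH.
exists z; split=> [B szB | B | [w Iw]].
- rewrite /z /e koszul_diff_basis big1 ?mulr0 // => l lT.
  case: eqP => [eB|]; rewrite ?mul0r //.
  by rewrite eB -cardT (cardsD1 l T) lT eqxx in szB.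
- rewrite dzE mulr_sumr; apply: is_ideal_sum => // p pB.
  rewrite /e koszul_diff_basis !mulr_sumr; apply: is_ideal_sum => // l lT.
  case: eqP => [eB|]; last by rewrite mul0r !mulr0; case: idI.
  have pT : p \in T.
    by apply: (subsetP (subsetDl T [set l])); rewrite -eB setU11.
  rewrite mul1r (_ : c * _ = koszul_sign S p B * koszul_sign S l (p |: B) * (c * x p * y l)).
    by apply: is_idealM => //; apply: cI.
  ring.
pose p0 := lshift m i0; pose l0 := rshift n j0.
have pl0 : p0 != l0 by rewrite eq_lrshift.
have p0T : p0 \in T by rewrite TG.
have l0T : l0 \in T by rewrite TH.
(* Only the term x_{i0} y_{j0} contributes to the entry of dz at B0. *)
pose B0 := T :\ l0 :\ p0.
have p0B0 : p0 \notin B0 by rewrite !inE eqxx.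
have dzB0 : koszul_diff (fun j => 'X_j) z B0 =
    koszul_sign S p0 B0 * koszul_sign S l0 (p0 |: B0) * (c * 'X_p0 * 'X_l0).
  rewrite dzE [koszul_diff x _ _]/koszul_diff (bigD1 p0) //= big1 ?addr0 => [|p].
    rewrite xl /e koszul_diff_basis (bigD1 l0) //= setD1K ?inE ?pl0 //.
    rewrite eqxx mul1r yr big1 => [|l /andP[lT ll0]]; first by ring.
    rewrite (_ : (_ == _) = false) ?mul0r //.
    by apply/negP => /eqP/setP/(_ l); rewrite !inE eqxx ll0 lT.
  case/andP => pB0 pp0; rewrite /e koszul_diff_basis.
  have [->|pl] := eqVneq p l0; first by rewrite xr mulr0 mul0r.
  rewrite big1 ?mulr0 // => l lT; rewrite (_ : (_ == _) = false) ?mul0r //.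
  apply/negP => /eqP/setP/(_ p); rewrite !inE eqxx /=.
  by move: pB0; rewrite !inE pp0 pl /= => /negPf ->; rewrite andbF.
have [h dz_order] : exists h,
    diagonal (koszul_diff (fun j => 'X_j) z B0) = 'X * ('X^(q + r) * h).
  have -> : koszul_diff (fun j => 'X_j) z B0 =
      koszul_diff (fun j => 'X_j) (fun B => z B - koszul_diff (fun j => 'X_j) w B) B0.
    transitivity (koszul_diff (fun j => 'X_j)
      (fun B => z B + -1 * koszul_diff (fun j => 'X_j) w B) B0).
      by rewrite koszul_diffD (koszul_diffZ _ (-1)) koszul_diffK mulr0 addr0.
    by apply: eq_koszul_diff => B; rewrite mulN1r.
  rewrite [koszul_diff _ _ _]/koszul_diff.
  apply: (big_ind (fun f : S => exists h, diagonal f = 'X * ('X^(q + r) * h))).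
  - by exists 0; rewrite raddf0 !mulr0.
  - move=> f g [h1 e1] [h2 e2].
    by exists (h1 + h2); rewrite rmorphD /= e1 e2 !mulrDr.
  move=> j _; have [h eh] := diagonal_mixed_product (Iw (j |: B0)).
  exists (diagonal (koszul_sign S j B0) * h).
  by rewrite !rmorphM /= eh diagonalX; ring.
move: dz_order; rewrite dzB0 !rmorphM /= !diagonalX !diagonal_prod /koszul_sign.
rewrite !rmorphXn !rmorphN1.
have -> : 'X^#|~: G| * 'X^#|~: H| * 'X * 'X = 'X^(q + r) :> {poly K}.
  by rewrite -Gq -Hr addSn addnS !exprSr exprD.
rewrite [LHS]mulrC [RHS]mulrCA => /(mulfI (monic_neq0 (monicXn _ _))) /(congr1 (horner^~ 0)).
rewrite -exprD hornerM hornerX mul0r -[- 1]polyCN horner_exp hornerC => /eqP.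
by rewrite signr_eq0.
Qed.

End MixedProducts.

(** * Depth and dimension of the quotient *)

Lemma card_ord_interval N (A : {set 'I_N}) s t :
  (forall i, i \in A -> s <= i < s + t)%N -> (#|A| <= t)%N.
Proof.
move=> At; rewrite cardE -(size_map val) -(size_iota s t).
apply: uniq_leq_size; first by rewrite (map_inj_uniq val_inj) enum_uniq.
by move=> _ /mapP[i iA ->]; rewrite mem_iota At // -mem_enum.
Qed.

Lemma subset_of_card N t : (t <= N)%N -> exists A : {set 'I_N}, #|A| = t.
Proof.
move=> tN; exists [set widen_ord tN i | i : 'I_t].
by rewrite card_imset ?card_ord // => i j /(congr1 val) eij; apply: val_inj.
Qed.

Section NumericalConsequences.
Variables (K : fieldType) (n m q r : nat).
Hypotheses (hq : (0 < q <= n)%N) (hr : (0 < r <= m)%N).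
Local Notation S := {mpoly K[n + m]}.
Local Notation I := (prod_ideal (x_sqfree_ideal K n m q) (y_sqfree_ideal K n m r)).

(** The class of degree (n - q.-1) + (m - r.-1) - 1 leaves room for at most
    q + r - 1 regular elements. *)
Lemma mixed_product_depth_le d : depth_quot I d -> (d <= (q + r).-1)%N.
Proof.
case=> -[fs [fs0 reg_fs <-]] _.
have [q0 qn] := andP hq; have [r0 rm] := andP hr.
have [A cardA] := @subset_of_card n q.-1 ltac:(lia).
have [B cardB] := @subset_of_card m r.-1 ltac:(lia).
have cA := cardsC A; have cB := cardsC B; rewrite !card_ord in cA cB.
have H := @mixed_product_koszul_class K n m q r (~: A) (~: B).
rewrite !setCK in H.
have := regular_seq_size (mixed_product_is_ideal _ _ _ _ _) fs0 reg_fs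
  (H ltac:(lia) ltac:(lia) ltac:(lia) ltac:(lia)).
move: cA cB {H}; rewrite cardA cardB.
by move: (size fs) #|~: A| #|~: B| => s a b; lia.
Qed.

Lemma mixed_product_vars_ideal (W : {set 'I_(n + m)}) f :
    (forall A : {set 'I_n}, #|A| = q -> exists2 i, i \in A & lshift m i \in W) \/
    (forall B : {set 'I_m}, #|B| = r -> exists2 j, j \in B & rshift n j \in W) ->
  I f -> kill_vars W f = 0.
Proof.
have idT : is_ideal (fun _ : S => True) by [].
have id0 : is_ideal (fun f : S => kill_vars W f = 0).
  split=> [|a g h g0 h0]; first by rewrite raddf0.
  by rewrite rmorphD rmorphM /= g0 h0 mulr0 addr0.
case=> HW; [apply: (mixed_product_min id0 id0 idT) | apply: (mixed_product_min id0 idT id0)] => //.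
- move=> A /HW[i iA iW]; rewrite rmorph_prod (bigD1 i) //= kill_varsX iW mul0r //.
- by move=> a b a0 _; rewrite rmorphM /= a0 mul0r.
- move=> B /HW[j jB jW]; rewrite rmorph_prod (bigD1 j) //= kill_varsX jW mul0r //.
- by move=> a b _ b0; rewrite rmorphM /= b0 mulr0.
Qed.

(** The first n - q + 1 of the x's meet every set of q of them, and the last
    m - r + 1 of the y's meet every set of r of them; the chains add the other
    variables in increasing, respectively decreasing, order. *)
Lemma mixed_product_dim_ge d :
  krull_dim_quot I d -> (m + q <= d.+1)%N /\ (n + r <= d.+1)%N.
Proof.
have [q0 qn] := andP hq; have [r0 rm] := andP hr.
case=> _ dim_le; split.
- pose W i := [set j : 'I_(n + m) | (j < n - q.-1 + i)%N].
  suff /dim_le : prime_chain I (fun i => vars_ideal (W i)) (m + q.-1) by lia.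
  apply: vars_prime_chain => [i f | i lt_i].
    apply: mixed_product_vars_ideal; left=> A cardA; apply/exists_inP.
    apply: contra_eqT cardA => /exists_inPn AW.
    suff : (#|A| <= q.-1)%N by lia.
    apply: (@card_ord_interval _ _ (n - q.-1)) => j /AW; rewrite inE /= -leqNgt.
    by have := ltn_ord j; lia.
  apply/properP; split; first by apply/subsetP => j; rewrite !inE; lia.
  have lt_v : (n - q.-1 + i < n + m)%N by lia.
  by exists (Ordinal lt_v); rewrite !inE /=; lia.
pose W i := [set j : 'I_(n + m) | (n + r.-1 <= j + i)%N].
suff /dim_le : prime_chain I (fun i => vars_ideal (W i)) (n + r.-1) by lia.
apply: vars_prime_chain => [i f | i lt_i].
  apply: mixed_product_vars_ideal; right=> B cardB; apply/exists_inP.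
  apply: contra_eqT cardB => /exists_inPn BW.
  suff : (#|B| <= r.-1)%N by lia.
  apply: (@card_ord_interval _ _ 0) => j /BW; rewrite inE /= -ltnNge; lia.
apply/properP; split; first by apply/subsetP => j; rewrite !inE; lia.
have lt_v : ((n + r.-1 - i).-1 < n + m)%N by lia.
by exists (Ordinal lt_v); rewrite !inE /=; lia.
Qed.

Lemma mixed_product_cm_eq : cohen_macaulay_quot I -> q = n /\ r = m.
Proof.
case=> d [/mixed_product_dim_ge[d1 d2] /mixed_product_depth_le d3]; lia.
Qed.

End NumericalConsequences.

(** * Minimal resolutions of a principal quotient *)

Section PrincipalResolution.
Variables (K : fieldType) (k : nat).
Local Notation S := {mpoly K[k]}.
Implicit Types (I : S -> Prop) (g : S).

Definition residue_mx s t (M : 'M[S]_(s, t)) : 'M[K]_(s, t) :=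
  map_mx (mcoeff 0%MM) M.

Lemma residue_mx_image0 r1 r0 (v : 'rV[S]_r1) (D : 'M[S]_(r1, r0)) :
  (forall a b, irrelevant_ideal (D a b)) -> residue_mx (v *m D) = 0.
Proof.
move=> D0; rewrite /residue_mx map_mxM.
rewrite (_ : map_mx _ D = 0) ?mulmx0 //.
by apply/matrixP => a b; rewrite !mxE; apply: D0.
Qed.

(** The hypothesis says that every basis vector is proportional to v modulo the
    irrelevant ideal, so that the identity of K^r1 has rank at most 1. *)
Lemma rank_le1 r1 (c : 'cV[S]_r1) (v : 'rV[S]_r1) :
  (forall b, residue_mx (delta_mx 0 b - (c b 0) *: v) = 0) -> (r1 <= 1)%N.
Proof.
move=> cv; rewrite -(mxrank1 K r1).
have -> : 1%:M = residue_mx c *m residue_mx v.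
  apply/matrixP => a b; have /matrixP/(_ 0 b) := cv a.
  rewrite !mxE big_ord1 !mxE mcoeffB rmorphM /= => /eqP.
  rewrite subr_eq0 => /eqP <-; rewrite eq_sym.
  by rewrite mcoeffMn mcoeff1 eqxx.
by apply: leq_trans (mxrankM_maxl _ _) (rank_leq_col _).
Qed.

(** F_0 has rank 1: if u lifts the generator 1 of S / I, each basis vector differs
    from a multiple of u by a syzygy, which vanishes modulo the irrelevant
    ideal by minimality. *)
Lemma cyclic_rank I r1 r0 (aug : 'cV[S]_r0) (D : 'M[S]_(r1, r0)) :
    is_ideal I -> (forall f, I f -> irrelevant_ideal f) ->
    (forall f, exists u : 'rV_r0, I ((u *m aug) 0 0 - f)) ->
    (forall u : 'rV_r0, I ((u *m aug) 0 0) -> exists v, u = v *m D) ->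
    (forall a b, irrelevant_ideal (D a b)) ->
  r0 = 1%N.
Proof.
move=> idI I0 surj ker D0; have [u Iu] := surj 1.
apply/eqP; rewrite eqn_leq; apply/andP; split; last first.
  rewrite lt0n; apply/eqP => r00; move: Iu.
  rewrite mxE big1 => [/I0|i _]; last by have := ltn_ord i; rewrite [X in (_ < X)%N]r00.
  by rewrite /irrelevant_ideal sub0r mcoeffN mcoeff1 eqxx => /eqP; rewrite oppr_eq0 oner_eq0.
apply: (@rank_le1 _ aug u) => b; have [|v ->] := ker (delta_mx 0 b - aug b 0 *: u).
  rewrite mulmxBl -rowE -scalemxAl !mxE -/((u *m aug) 0 0).
  have -> : aug b 0 - aug b 0 * \sum_j u 0 j * aug j 0 =
      - aug b 0 * (\sum_j u 0 j * aug j 0 - 1) by ring.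
  by apply: is_idealM => //; rewrite mxE in Iu.
exact: residue_mx_image0.
Qed.

(** F_1 has rank 1: the image of D in F_0 = S is (g), because the augmentation is
    invertible modulo g.  If v is mapped to g, then the basis vector b, mapped to
    s b * g, differs from s b *: v by a syzygy. *)
Lemma principal_rank1 g r1 r2 (aug : 'cV[S]_1) (D : 'M[S]_(r1, 1)) (D1 : 'M[S]_(r2, r1)) :
    g != 0 ->
    (exists u : 'rV_1, exists h, (u *m aug) 0 0 - 1 = h * g) ->
    (forall u : 'rV_1, (exists h, (u *m aug) 0 0 = h * g) <-> exists v, u = v *m D) ->
    (forall u : 'rV_r1, u *m D = 0 -> exists v, u = v *m D1) ->
    (forall a b, irrelevant_ideal (D1 a b)) ->
  r1 = 1%N /\ D != 0.
Proof.
move=> g0 [u [h uh]] ker0 ker1 D10.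
rewrite mxE big_ord1 in uh.
have imD (f : S) : (exists h, f = h * g) <-> exists v, f%:M = v *m D :> 'rV_1.
  rewrite -ker0 mxE big_ord1 mxE eqxx mulr1n; split=> -[a ea].
    by exists (a * aug 0 0); rewrite ea; ring.
  exists (u 0 0 * a - f * h).
  by rewrite mulrBl -mulrA -ea -[f * h * g]mulrA -uh; ring.
have [|v gv] := (imD g).1; first by exists 1; rewrite mul1r.
have D0 : D != 0.
  apply: contraNneq g0 => D0; move: gv; rewrite D0 mulmx0 => /matrixP/(_ 0 0).
  by rewrite !mxE eqxx mulr1n => ->.
split=> //; apply/eqP; rewrite eqn_leq; apply/andP; split; last first.
  rewrite lt0n; apply: contraNneq D0 => r10.
  by apply/eqP/matrixP => i; have := ltn_ord i; rewrite [X in (_ < X)%N]r10.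
have /fin_all_exists[s sE] : forall b, exists a, D b 0 = a * g.
  move=> b; apply/imD; exists (delta_mx 0 b); rewrite -rowE.
  by apply/matrixP => i j; rewrite !ord1 !mxE eqxx mulr1n.
apply: (@rank_le1 _ (\col_b s b) v) => b.
have [|w ->] := ker1 (delta_mx 0 b - (\col_b s b) b 0 *: v).
  rewrite mulmxBl -rowE -scalemxAl -gv.
  by apply/matrixP => i j; rewrite !ord1 !mxE sE eqxx mulr1n subrr.
exact: residue_mx_image0.
Qed.

(** A zero map has all of its source as kernel, and a minimal presentation of
    that kernel covers nothing modulo the irrelevant ideal. *)
Lemma trivial_kernel_rank r1 r2 r3 (D1 : 'M[S]_(r2, r1)) (D2 : 'M[S]_(r3, r2)) :
    D1 = 0 -> (forall u : 'rV_r2, u *m D1 = 0 -> exists v, u = v *m D2) ->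
    (forall a b, irrelevant_ideal (D2 a b)) ->
  r2 = 0%N.
Proof.
move=> -> ker D20; apply/eqP; rewrite -leqn0 leqNgt; apply/negP => r20.
have [|v e] := ker (delta_mx 0 (Ordinal r20)); first by rewrite mulmx0.
have /matrixP/(_ 0 (Ordinal r20)) := residue_mx_image0 v D20.
by rewrite -e !mxE !eqxx mcoeff1 eqxx => /eqP; rewrite oner_eq0.
Qed.

Lemma rank1_kernel r1 r0 (D : 'M[S]_(r1, r0)) (u : 'rV_r1) :
  r1 = 1%N -> D != 0 -> u *m D = 0 -> u = 0.
Proof.
move=> r11; move: D u; rewrite {}r11 => D u D0 /matrixP uD0.
have [a /existsP[b Dab]] : exists a, [exists b, D a b != 0].
  apply/existsP; apply: contraNT D0; rewrite negb_exists => /forallP D0.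
  apply/eqP/matrixP => a b; apply/eqP; rewrite mxE -[_ == _]negbK.
  by have := D0 a; rewrite negb_exists => /forallP; apply.
apply/matrixP => i j; have := uD0 0 b.
rewrite !ord1 !mxE big_ord1 => /eqP.
by rewrite ord1 in Dab; rewrite mulf_eq0 (negPf Dab) orbF => /eqP.
Qed.

(** The ranks are 1, 1, 0, 0, ...: the map F_1 -> F_0 is injective, being nonzero
    between modules of rank 1 over a domain, so F_2 -> F_1 is zero, and from
    there on the modules vanish one after the other. *)
Lemma principal_last_rank I g (F : min_graded_free_res I) :
    (forall f, I f <-> exists h, f = h * g) -> g != 0 -> irrelevant_ideal g ->
  res_rank F (res_length F) = 1%N.
Proof.
move=> IE g0 gm.
have idI : is_ideal I.
  have [P0 PD] := principal_is_ideal g.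
  by split=> [|a f1 f2 /IE Pf1 /IE Pf2]; apply/IE; [exact: P0 | exact: PD].
have I0 f : I f -> irrelevant_ideal f.
  by move=> /IE[h ->]; rewrite /irrelevant_ideal rmorphM /= gm mulr0.
case: F => len rk sh aug d last gt _ _ surj ex0 exS mini /=.
have r0 : rk 0%N = 1%N.
  by apply: (cyclic_rank idI I0 surj _ (@mini 0%N)) => u /ex0.
have [r1 d0] : rk 1%N = 1%N /\ d 0%N != 0.
  have [u Iu] := surj 1; move: aug (d 0%N) (d 1%N) ex0 (exS 0%N) (@mini 1%N) u Iu {surj}.
  rewrite r0 => aug D D1 ex0 ex1 m1 u /IE Iu.
  apply: (@principal_rank1 g _ _ aug D D1) => //; first by exists u.
    by move=> w; rewrite -ex0 IE.
  by move=> w /ex1.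
have r2 : rk 2%N = 0%N.
  apply: (@trivial_kernel_rank _ _ _ (d 1%N) (d 2%N)); last exact: mini.
    apply/row_matrixP => a; rewrite row0; apply: (rank1_kernel r1 d0).
    by apply/exS; exists (delta_mx 0 a); rewrite rowE.
  by move=> u /exS.
have r_ge2 i : rk i.+2 = 0%N.
  elim: i => // i IHi.
  apply: (@trivial_kernel_rank _ _ _ (d i.+2) (d i.+3)); last exact: mini.
    by apply/matrixP => a b; have := ltn_ord b; rewrite [X in (_ < X)%N]IHi.
  by move=> u /exS.
by case: len last gt => [|[|len]] //; rewrite r_ge2.
Qed.

Section Explicit.
Variables (I : S -> Prop) (g : S) (e : nat).
Hypotheses (IE : forall f, I f <-> exists h, f = h * g).
Hypotheses (g0 : g != 0) (gm : irrelevant_ideal g) (ge : g \is e.-homog).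

Let rk i : nat := (i < 2)%N.
Let dif i : 'M[S]_(rk i.+1, rk i) := const_mx (if i == 0%N then g else 0).

Definition principal_res : min_graded_free_res I.
Proof.
apply: (@MinGradedFreeRes K k I 1 rk (fun i _ => if i == 0%N then 0 else e%:Z)
  (const_mx 1) dif).
- by [].
- by case=> [|[|i]].
- by move=> a; rewrite mxE; apply: dhomog1.
- by case=> [|i] [a alt] b //; rewrite mxE; change (homog_of_deg g (e%:Z - 0)); rewrite subr0.
- move=> f; exists (const_mx f); rewrite mxE big_ord1 !mxE mulr1 subrr.
  by apply/IE; exists 0; rewrite mul0r.
- move=> u; rewrite mxE big_ord1 mxE mulr1 IE; split=> [[h uh]|[v ->]].
    exists (const_mx h); apply/matrixP => i j; rewrite !ord1 !mxE big_ord1 !mxE.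
    exact: uh.
  by exists (v 0 0); rewrite mxE big_ord1 mxE.
- case=> [|i] u; last first.
    split=> _; last first.
      by apply/matrixP => a b; rewrite mxE [RHS]mxE big_ord0.
    by exists 0; apply/matrixP => a b; case: (notF (ltn_ord b)).
  split=> [/matrixP/(_ 0 0)|[v ->]]; last first.
    by apply/matrixP => a b; rewrite !mxE big_ord1 !mxE big_ord0 mul0r.
  rewrite !mxE big_ord1 !mxE /= => /eqP; rewrite mulf_eq0 (negPf g0) orbF => /eqP u0.
  by exists 0; rewrite mul0mx; apply/matrixP => a b; rewrite !ord1 mxE.
- by case=> [|i] [a alt] b //; rewrite mxE.
Defined.

Lemma principal_cm_type : cm_type_quot I 1.
Proof.
split=> [|t [F ->]]; first by exists principal_res.
by rewrite (principal_last_rank F IE).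
Qed.

End Explicit.
End PrincipalResolution.

(** * The product of all the variables *)

Section FullProduct.
Variables (K : fieldType) (n m : nat).
Local Notation S := {mpoly K[n + m]}.
Local Notation I := (prod_ideal (x_sqfree_ideal K n m n) (y_sqfree_ideal K n m m)).

Let xs (A : {set 'I_n}) : S := \prod_(i in A) 'X_(lshift m i).
Let ys (B : {set 'I_m}) : S := \prod_(j in B) 'X_(rshift n j).

Lemma prod_vars_homog (k : nat) (T : finType) (A : {set T}) (v : T -> 'I_k) :
  (\prod_(i in A) 'X_(v i) : {mpoly K[k]}) \is #|A|.-homog.
Proof.
rewrite -sum1_card; apply: (big_rec2 (fun d (f : {mpoly K[k]}) => f \is d.-homog)).
  exact: dhomog1.
by move=> i d f _ fh; apply: dhomogM => //; rewrite dhomogX; apply/eqP/mdeg1.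
Qed.

Lemma full_product_principal f :
  I f <-> exists h, f = h * (xs setT * ys setT).
Proof.
have idP (g : S) := principal_is_ideal g.
split=> [|[h ->]].
  apply: (mixed_product_min (idP _) (idP (xs setT)) (idP (ys setT))) => [A An|B Bm|].
  - exists 1; rewrite mul1r (_ : A = setT) //.
    by apply/eqP; rewrite eqEcard subsetT cardsT card_ord An leqnn.
  - exists 1; rewrite mul1r (_ : B = setT) //.
    by apply/eqP; rewrite eqEcard subsetT cardsT card_ord Bm leqnn.
  by move=> _ _ [h1 ->] [h2 ->]; exists (h1 * h2); ring.
apply: is_idealM; first exact: mixed_product_is_ideal.
by apply: mixed_product_gen; rewrite cardsT card_ord.
Qed.

Lemma full_product_cm_type : (0 < n)%N -> cm_type_quot I 1.
Proof.
move=> n_gt0; have gh : xs setT * ys setT \is (n + m).-homog.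
  have := dhomogM (prod_vars_homog setT (@lshift n m))
    (prod_vars_homog setT (@rshift n m)).
  by rewrite !cardsT !card_ord.
apply: (principal_cm_type full_product_principal _ _ gh).
  apply/eqP => /(congr1 (@diagonal K (n + m))) /eqP.
  by rewrite rmorphM /= !diagonal_prod raddf0 -exprD (negPf (monic_neq0 (monicXn _ _))).
by apply: dhomog_nemf_coeff gh _; rewrite /= mdeg0 eq_sym addn_eq0 negb_and -lt0n n_gt0.
Qed.

End FullProduct.

Local Close Scope ring_scope.

Theorem proposition4p4 (K : fieldType) (n m q r : nat)
    (hq : 0 < q <= n) (hr : 0 < r <= m) :
  cohen_macaulay_quot
    (prod_ideal (x_sqfree_ideal K n m q) (y_sqfree_ideal K n m r)) ->
  [/\ q = n, r = m &
      cm_type_quot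
        (prod_ideal (x_sqfree_ideal K n m q) (y_sqfree_ideal K n m r)) 1].
Proof.
move=> cmI; have [qn rm] := mixed_product_cm_eq hq hr cmI.
by split=> //; rewrite qn rm; apply: full_product_cm_type; have := andP hq; lia.
Qed.
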